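(* Let $r,n\ge 1$ be integers and let $\mathbf S=(s_{\ell,k})_{1\le \ell\le r,\,1\le k\le n}$ and $\mathbf T=(t_{\ell,k})_{1\le \ell\le r,\,1\le k\le n}$ be elements of $\mathbb C^r\otimes\mathbb C^n$. Then $$ \left|\left\langle \mathbf S,\mathbf T\right\rangle_{\mathbb C^r\otimes\mathbb C^n}\right|^2\le \min(r,n)\,\left\|\left\langle \mathbf S,\mathbf T\right\rangle_{\mathbb C^n}\right\|^2_{\mathbb C^r\otimes\mathbb C^r}. $$
   Context: Elements of $\mathbb C^r\otimes\mathbb C^n$ are identified with complex $r\times n$ matrices. $\langle\cdot,\cdot\rangle_{\mathbb C^r\otimes\mathbb C^n}$ is the standard inner product, $\langle \mathbf S,\mathbf T\rangle_{\mathbb C^r\otimes\mathbb C^n}=\sum_{\ell=1}^r\sum_{k=1}^n s_{\ell,k}\overline{t_{\ell,k}}$. $\langle \mathbf S,\mathbf T\rangle_{\mathbb C^n}$ denotes the element of $\mathbb C^r\otimes\mathbb C^r$ obtained by taking the inner product only in the $\mathbb C^n$ factor, i.e. the $r\times r$ matrix with $(m,\ell)$ entry $\sum_{k=1}^n s_{m,k}\overline{t_{\ell,k}}$, and $\|\cdot\|_{\mathbb C^r\otimes\mathbb C^r}$ is the Euclidean (Hilbert-Schmidt) norm, so that $\|\langle \mathbf S,\mathbf T\rangle_{\mathbb C^n}\|^2_{\mathbb C^r\otimes\mathbb C^r}=\sum_{1\le m,\ell\le r}\left|\sum_{k=1}^n s_{m,k}\overline{t_{\ell,k}}\right|^2$.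 (Replacing $\mathbf T$ by its complex conjugate gives the equivalent inequality with $t_{\ell,k}$ in place of $\overline{t_{\ell,k}}$.) *)

(* Defs.v *)
From mathcomp Require Import all_boot all_order all_algebra.
From mathcomp Require Import complex reals.

Set Implicit Arguments.
Unset Strict Implicit.
Unset Printing Implicit Defensive.

Import Order.TTheory GRing.Theory Num.Theory.
Local Open Scope ring_scope.

Section TensorInner.

Variables (R : realType) (r n : nat).
Implicit Types S T : 'M[R[i]]_(r, n).

Definition inner S T : R[i] := \sum_(l < r) \sum_(k < n) S l k * (T l k)^*.

Definition partial_inner S T : 'M[R[i]]_r :=
  \matrix_(m < r, l < r) \sum_(k < n) S m k * (T l k)^*.

End TensorInner.

(* Its value is a nonnegative real element of R[i], like that of the norm
   `|z| of a complex number; the order of R[i] compares such elements as real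
   numbers. *)
Definition hs_norm (R : realType) (r n : nat) (A : 'M[R[i]]_(r, n)) : R[i] :=
  sqrtC (inner A A).

(* Main.v *)
Require Import Defs.
From mathcomp Require Import all_boot all_order all_algebra.
From mathcomp Require Import complex reals.

Import Order.TTheory GRing.Theory Num.Theory.
Local Open Scope ring_scope.
Local Open Scope sesquilinear_scope.

(** Write [M^H] for the conjugate transpose of [M] and put [A = S T^H]: then
    [partial_inner S T] is [A] itself and [inner S T] is the trace of [A].  Since
    the [r x r] matrix [A] factors through a space of dimension [n], its rank is
    at most [minn r n], so it is enough to bound [|tr A|^2] by [rank A] times the
    squared Hilbert-Schmidt norm of [A] ([normCK_mxtrace_le_rank]).

    For this, choose an orthonormal basis of the row space of [A], stored as the
    rows of a matrix [Q] with [rank A] rows, and write [A = D Q].  Then [tr A] is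
    the Hilbert-Schmidt inner product of [D] with [Q^H].  Here [D] has the same
    norm as [A], because [Q Q^H = 1], and the squared norm of [Q^H] is the trace
    of that identity matrix, which is [rank A].  The Cauchy-Schwarz inequality
    for the Hilbert-Schmidt product ([mxtrace_CauchySchwarz]) concludes. *)

Lemma dotmx_mxvec (C : numClosedFieldType) m n (A B : 'M[C]_(m, n)) :
  dotmx (mxvec A) (mxvec B) = \tr (A *m B ^t*).
Proof.
rewrite dotmxE mxE (reindex _ (curry_mxvec_bij m n)) /=.
transitivity (\sum_i \sum_j A i j * (B i j)^*).
  rewrite pair_bigA; apply: eq_bigr => -[i j] _.
  by rewrite !mxE /= !mxvecE.
apply: eq_bigr => i _; rewrite mxE; apply: eq_bigr => j _.
by rewrite !mxE.
Qed.

Lemma mxtrace_CauchySchwarz (C : numClosedFieldType) m n (A B : 'M[C]_(m, n)) :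
  `|\tr (A *m B ^t*)| ^+ 2 <= \tr (A *m A ^t*) * \tr (B *m B ^t*).
Proof.
rewrite -!dotmx_mxvec.
by have [] := CauchySchwarz (@dotmx C (m * n)) (mxvec A) (mxvec B).
Qed.

(** Applying Cauchy-Schwarz to [A] and the identity would only give the size of
    [A] as constant; the rank appears once the identity is replaced by an
    orthonormal basis of the row space of [A]. *)
Lemma normCK_mxtrace_le_rank (C : numClosedFieldType) n (A : 'M[C]_n) :
  `|\tr A| ^+ 2 <= (\rank A)%:R * \tr (A *m A ^t*).
Proof.
set Q := schmidt (row_base A).
have Qunitary : Q \is unitarymx by rewrite schmidt_unitarymx ?rank_leq_col.
have /submxP[D defA] : (A <= Q)%MS.
  by rewrite (submx_trans _ (schmidt_sub _)) ?eq_row_base.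
have normD : \tr (A *m A ^t*) = \tr (D *m D ^t*).
  by rewrite {1 2}defA trmx_mul map_mxM mulmxA mulmxtVK.
have normQ : \tr (Q ^t* *m Q ^t* ^t*) = (\rank A)%:R.
  by rewrite trmxCK mxtrace_mulC (unitarymxP _) // mxtrace1.
have := mxtrace_CauchySchwarz _ _ _ D (Q ^t*).
by rewrite normQ trmxCK -defA normD mulrC.
Qed.

Lemma partial_innerE (R : realType) (r n : nat) (S T : 'M[R[i]]_(r, n)) :
  partial_inner S T = S *m T ^t*.
Proof.
by apply/matrixP => m l; rewrite !mxE; apply: eq_bigr => k _; rewrite !mxE.
Qed.

Lemma innerE (R : realType) (r n : nat) (S T : 'M[R[i]]_(r, n)) :
  inner S T = \tr (S *m T ^t*).
Proof. by rewrite -partial_innerE; apply: eq_bigr => l _; rewrite mxE. Qed.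

Theorem proposition2p1 (R : realType) (r n : nat) (hr : (1 <= r)%N)
    (hn : (1 <= n)%N) (S T : 'M[R[i]]_(r, n)) :
  `|inner S T| ^+ 2 <= (minn r n)%:R * hs_norm (partial_inner S T) ^+ 2.
Proof.
rewrite /hs_norm sqrtCK innerE partial_innerE innerE.
apply: le_trans (normCK_mxtrace_le_rank _ _ _) _.
have rank_le : (\rank (S *m T ^t*) <= minn r n)%N.
  by rewrite leq_min rank_leq_row (leq_trans (mxrankM_maxl _ _)) ?rank_leq_col.
by rewrite ler_wpM2r ?ler_nat // -dotmx_mxvec dnorm_ge0.
Qed.
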